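(* Let $P$ be a nonempty set, $X$ and $Y$ metric spaces, $F:P\times X\rightrightarrows Y$ a set-valued mapping, $\bar x\in X$, $\bar y\in Y$, $\alpha>0$, $\delta\in]0,+\infty]$ and $\mu\in]0,+\infty]$. For $\gamma>0$, $p\in P$ and $(x,y)\in\operatorname{gph}F_p$ consider the inequality $$(\ast)\qquad \limsup_{\substack{u\to x,\ v\to y,\ (u,v)\in\operatorname{gph} F_p,\ (u,v)\ne (x,y)\\ d(u,\bar x)<\delta+\mu,\ d(v,\bar y)<\alpha\mu}} \frac{d(y,\bar y)-d(v,\bar y)}{d_\gamma((u,v),(x,y))}\ge\alpha .$$ (i) Suppose $X$ and $Y$ are normed spaces, and $\operatorname{gph}F_p$ is convex for all $p\in P$. If $F$ is $\alpha$-subregular in $x$ uniformly in $p$ over $P$ at $(\bar x,\bar y)$ with $\delta$ and $\mu$, then $(\ast)$ holds with $\gamma:=\alpha^{-1}$ for all $p\in P$, $x\in B_\delta(\bar x)$ and $y\in Y$ satisfying $x\notin F_p^{-1}(\bar y)$ and $y\in F(p,x)\cap B_{\alpha\mu}(\bar y)$. (ii) Suppose $X$ and $Y$ are complete, and $\operatorname{gph}F_p$ is closed for all $p\in P$. If there is a $\gamma>0$ such that $(\ast)$ holds for all $p\in P$, $x\in B_{\delta+\mu}(\bar x)$ and $y\in Y$ satisfying $x\notin F_p^{-1}(\bar y)$ and $y\in F(p,x)\cap B_{\alpha\mu}(\bar y)$, then $F$ is $\alpha$-subregular in $x$ uniformly in $p$ over $P$ at $(\bar x,\bar y)$ with $\delta$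 and $\mu$.
   Context: $B_r(z)$ denotes the open ball with center $z$ and radius $r\in]0,+\infty]$ (the whole space if $r=+\infty$). $d(z,\Omega):=\inf_{w\in\Omega}d(z,w)$, with $d(z,\emptyset)=+\infty$. For $p\in P$, $F_p:=F(p,\cdot):X\rightrightarrows Y$, $\operatorname{gph}F_p=\{(x,y)\in X\times Y\mid y\in F(p,x)\}$, $F_p^{-1}(y)=\{x\in X\mid y\in F(p,x)\}$. Values of set-valued mappings may be empty. For $\gamma>0$, $d_\gamma((u,v),(x,y)):=\max\{d(u,x),\gamma\, d(v,y)\}$ on $X\times Y$. In normed spaces, $d$ is the distance induced by the norm. Definition. $F$ is $\alpha$-subregular in $x$ uniformly in $p$ over $P$ at $(\bar x,\bar y)$ with $\delta$ and $\mu$ if $\alpha\, d(x,F_p^{-1}(\bar y))\le d(\bar y,F(p,x))$ for all $p\in P$ and $x\in B_\delta(\bar x)$ with $d(\bar y,F(p,x))<\alpha\mu$. The upper limit is $\lim_{\rho\downarrow0}$ of the supremum over the indicated $(u,v)$ with $d(u,x)<\rho$, $d(v,y)<\rho$; a supremum over the empty set is understood as $-\infty$. *)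

(* Defs.v *)
From HB Require Import structures.
From mathcomp Require Import all_boot all_order all_algebra.
From mathcomp Require Import all_classical all_reals all_analysis.

Set Implicit Arguments.
Unset Strict Implicit.
Unset Printing Implicit Defensive.

Import Order.TTheory GRing.Theory Num.Theory.
Import numFieldNormedType.Exports.

Local Open Scope classical_set_scope.
Local Open Scope ring_scope.

(* The library's [completeType] is pointed, so this is the structure of
   nonempty complete metric spaces. *)
#[short(type="completeMetricType")]
HB.structure Definition CompleteMetric (K : numDomainType) :=
  {T of CompletePseudoMetric K T & Metric K T}.

(* The library does not derive a [metricType] from a [normedModType]; this
   alias keeps all the structures of V and adds the distance of the norm. *)
Definition norm_metric (R : realType) (V : normedModType R) : Type := V.

Section norm_metric.
Context {R : realType} {V : normedModType R}.

HB.instance Definition _ := NormedModule.on (norm_metric V).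

Let dist (x y : norm_metric V) : R := `|x - y|.

Let dist_ge0 x y : 0 <= dist x y.
Proof. exact: normr_ge0. Qed.

Let dist_positivity x y : dist x y = 0 -> x = y.
Proof. by move=> /normr0_eq0/subr0_eq. Qed.

Let ball_dist (x : norm_metric V) d : ball x d = [set y | dist x y < d].
Proof. by rewrite -ball_normE. Qed.

HB.instance Definition _ := PseudoMetric_isMetric.Build R (norm_metric V)
  dist_ge0 dist_positivity ball_dist.

End norm_metric.

Lemma mdist_norm_metric (R : realType) (V : normedModType R)
    (x y : norm_metric V) : mdist x y = `|x - y|.
Proof. by []. Qed.

(* The radius is extended: eball z +oo is the whole space. *)
Definition eball (R : realType) (X : metricType R) (z : X) (r : \bar R) :
  set X := [set w | ((mdist w z)%:E < r)%E].

(* Infimum in \bar R, hence +oo when A is empty. *)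
Definition dist_set (R : realType) (X : metricType R) (z : X) (A : set X) :
  \bar R := ereal_inf [set (mdist z w)%:E | w in A].

Definition gph (X Y : Type) (G : X -> set Y) : set (X * Y) :=
  [set z | G z.1 z.2].

Definition inv_image (X Y : Type) (G : X -> set Y) (y : Y) : set X :=
  [set x | G x y].

Definition dmax (R : realType) (X Y : metricType R) (gamma : R)
  (w z : X * Y) : R :=
  Num.max (mdist w.1 z.1) (gamma * mdist w.2 z.2).

Definition sup_near (R : realType) (X Y : metricType R)
  (q : X * Y -> R) (A : set (X * Y)) (z : X * Y) (rho : R) : \bar R :=
  ereal_sup [set (q w)%:E | w in
    [set w | [/\ A w, mdist w.1 z.1 < rho & mdist w.2 z.2 < rho]]].

Definition upper_limit (R : realType) (X Y : metricType R)
  (q : X * Y -> R) (A : set (X * Y)) (z : X * Y) : \bar R :=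
  lim (sup_near q A z rho @[rho --> 0^'+]).

(* The limit in [upper_limit] always exists. *)
Lemma is_cvg_sup_near (R : realType) (X Y : metricType R)
  (q : X * Y -> R) (A : set (X * Y)) (z : X * Y) :
  cvg (sup_near q A z rho @[rho --> 0^'+]).
Proof.
apply: nondecreasing_at_right_is_cvge; near=> e => r s _ _ rs.
apply: ge_ereal_sup => _ [w [Aw w1 w2] <-]; apply: ereal_sup_ubound; exists w => //.
by split=> //; [exact: lt_le_trans w1 rs|exact: lt_le_trans w2 rs].
Unshelve. all: by end_near. Qed.

Definition slope_condition (R : realType) (X Y : metricType R)
  (G : X -> set Y) (xbar : X) (ybar : Y) (alpha : R) (delta mu : \bar R)
  (gamma : R) (x : X) (y : Y) : Prop :=
  (alpha%:E <=
   upper_limit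
     (fun w : X * Y =>
        ((mdist y ybar - mdist w.2 ybar) / dmax gamma w (x, y))%R)
     [set w : X * Y |
        [/\ gph G w, w <> (x, y),
            ((mdist w.1 xbar)%:E < delta + mu)%E &
            ((mdist w.2 ybar)%:E < alpha%:E * mu)%E]]
     (x, y))%E.

Definition uniformly_subregular (R : realType) (P : Type)
  (X Y : metricType R) (F : P -> X -> set Y) (xbar : X) (ybar : Y)
  (alpha : R) (delta mu : \bar R) : Prop :=
  forall (p : P) (x : X),
    eball xbar delta x ->
    (dist_set ybar (F p x) < alpha%:E * mu)%E ->
    (alpha%:E * dist_set x (inv_image (F p) ybar)
       <= dist_set ybar (F p x))%E.

(* Main.v *)
(* (i) By subregularity x has almost-projections xh on the set of solutions,
   with alpha |x - xh| only slightly above |y - ybar|. By convexity the segment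
   from (x, y) to (xh, ybar) stays in the graph, and along it the quotient is
   constant and almost alpha.
   (ii) If subregularity fails at x, pick y in F(p, x) with
   d(y, ybar) < c min(d(x, F_p^-1(ybar)), mu) for some c < alpha, and apply
   Ekeland's principle with slope c to (u, v) |-> d(v, ybar) on the complete
   graph with the distance d_gamma, starting from (x, y). The resulting point
   is still in the region where the slope condition holds, which contradicts
   its Ekeland-minimality. *)
Require Import Defs.
From mathcomp Require Import all_boot all_order all_algebra.
From mathcomp Require Import lra.
From mathcomp Require Import all_classical all_reals all_analysis.

Set Implicit Arguments.
Unset Strict Implicit.
Unset Printing Implicit Defensive.

Import Order.TTheory GRing.Theory Num.Theory.
Import numFieldNormedType.Exports.

Local Open Scope classical_set_scope.
Local Open Scope ring_scope.

(** * Ekeland's variational principle *)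

(* The distance is a plain function, not a structure on T, because d_gamma is
   not the canonical distance on a product. *)
Section ekeland.
Context {R : realType} {T : choiceType}.
Variables (d : T -> T -> R) (A : set T) (f : T -> R).
Hypothesis dxx : forall x, d x x = 0.
Hypothesis d_pos : forall x y, d x y <= 0 -> x = y.
Hypothesis d_sym : forall x y, d x y = d y x.
Hypothesis d_triangle : forall x y z, d x z <= d x y + d y z.
Hypothesis complete_A : forall u : nat -> T, (forall n, A (u n)) ->
  (forall e, 0 < e -> exists N, forall n, (N <= n)%N -> d (u N) (u n) <= e) ->
  exists2 l, A l & forall e, 0 < e -> \forall n \near \oo, d (u n) l < e.
Hypothesis f_ge0 : forall x, A x -> 0 <= f x.
Hypothesis f_lsc : forall x e, 0 < e ->
  exists2 r, 0 < r & forall y, A y -> d y x < r -> f x <= f y + e.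

(** Lower section of [z] in Ekeland's order: the step to [w] costs [c * d z w], paid for by the
    decrease of [f]. *)
Let S c z := [set w | A w /\ f w + c * d z w <= f z].

Let S_trans c x y z : 0 < c -> S c x y -> S c y z -> S c x z.
Proof.
move=> c0 [Ay xy] [Az yz]; split=> //.
have := ler_wpM2l (ltW c0) (d_triangle x y z); rewrite mulrDr => xyz; lra.
Qed.

(** An almost-minimiser of [f] on [S c z]. The default [z] of [xget] is never reached when [A z]
    holds: [f] is bounded below on the nonempty section. *)
Let next c n z : T := xget z
  [set w | S c z w /\ forall v, S c z v -> f w <= f v + n.+1%:R^-1].

Let nextP c n z : A z -> S c z (next c n z) /\
  forall v, S c z v -> f (next c n z) <= f v + n.+1%:R^-1.
Proof.
move=> Az; rewrite /next; case: xgetP => [w _ [] //|none].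
have Szz : S c z z by split=> //; rewrite dxx mulr0 addr0.
have infS : has_inf (f @` S c z).
  split; first by exists (f z), z.
  by exists 0 => _ [w [Aw _] <-]; exact: f_ge0.
have n0 : 0 < n.+1%:R^-1 :> R by rewrite invr_gt0 ltr0n.
have [_ [w Sw <-] fw] := inf_adherent n0 infS.
case: (none w); split=> // v Sv; apply: le_trans (ltW fw) _.
by rewrite lerD2r; apply: ge_inf; [exact: infS.2|exists v].
Qed.

(** Iterating [next] from [x] gives nested sections with radii tending to 0. The limit [l] of the
    iterates lies in all of them, and so does every [w] in the section of [l]; hence [w = l]. *)
Lemma ekeland (c : R) (x : T) : 0 < c -> A x ->
  exists l, [/\ A l, f l + c * d x l <= f x &
    forall w, A w -> f w + c * d l w <= f l -> w = l].
Proof.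
move=> c0 Ax.
have [u [u0 uS]] : exists u : nat -> T,
    u 0%N = x /\ forall n, u n.+1 = next c n (u n).
  by exists (fix u n := if n is n'.+1 then next c n' (u n') else x).
have Au n : A (u n).
  by elim: n => [|n Aun]; rewrite ?u0 ?uS//; have [[]] := nextP c n Aun.
have Su m n : (m <= n)%N -> S c (u m) (u n).
  elim: n => [|n IH].
    by rewrite leqn0 => /eqP ->; split=> //; rewrite dxx mulr0 addr0.
  rewrite leq_eqVlt => /predU1P[->|/IH Smn].
    by split=> //; rewrite dxx mulr0 addr0.
  by apply: S_trans Smn _ => //; rewrite uS; have [] := nextP c n (Au n).
(* [w] also lies in [S c (u n)], on which [u n.+1] is minimal up to 1/(n+1), so [f] drops by at most
   that much from [u n.+1] to [w]. *)
have Su_small n w : S c (u n.+1) w -> d (u n.+1) w <= n.+1%:R^-1 / c.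
  move=> Sw; rewrite ler_pdivlMr// mulrC.
  have fw : f (u n.+1) <= f w + n.+1%:R^-1.
    rewrite uS; apply: (nextP c n (Au n)).2.
    by apply: S_trans Sw => //; exact: Su.
  by rewrite -(lerD2l (f w)); exact: le_trans Sw.2 fw.
have small e : 0 < e -> exists n : nat, n.+1%:R^-1 / c <= e.
  move=> e0; exists (Num.truncn (e * c)^-1).
  rewrite ler_pdivrMr// -[leRHS]invrK lef_pV2 ?posrE ?ltr0n ?invr_gt0 ?mulr_gt0//.
  exact/ltW/truncnS_gt.
have [l Al ul] : exists2 l, A l &
    forall e, 0 < e -> \forall n \near \oo, d (u n) l < e.
  apply: complete_A => // e /small [n ne]; exists n.+1 => m nm.
  exact: le_trans (Su_small _ _ (Su _ _ nm)) ne.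
(* Sections are closed: for large [m], half of [e] absorbs the semicontinuity of [f] at [l], the
   other half [c * d (u m) l]. *)
have Sl n : S c (u n) l.
  split=> //; apply/ler_addgt0Pr => e e0.
  have e20 : 0 < e / 2 by rewrite divr_gt0.
  have ec0 : 0 < e / 2 / c by rewrite divr_gt0.
  have [r r0 fr] := f_lsc l e20.
  near \oo => m.
  have nm : (n <= m)%N by near: m; exact: nbhs_infty_ge.
  have /(fr _ (Au m)) : d (u m) l < r by near: m; exact: ul.
  have : d (u m) l < e / 2 / c by near: m; exact: ul.
  rewrite ltr_pdivlMr// mulrC.
  have [_] := Su _ _ nm.
  have := ler_wpM2l (ltW c0) (d_triangle (u n) (u m) l).
  rewrite mulrDr; lra.
exists l; split=> //; first by have [] := Sl 0%N; rewrite u0.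
move=> w Aw Slw; apply: d_pos; apply/ler_addgt0Pr => e e0; rewrite add0r.
have e20 : 0 < e / 2 by rewrite divr_gt0.
have [n ne] := small _ e20.
have dl := le_trans (Su_small _ _ (Sl n.+1)) ne.
have dw := le_trans (Su_small _ _ (S_trans c0 (Sl n.+1) (conj Aw Slw))) ne.
have := d_triangle w (u n.+1) l.
by rewrite (d_sym w (u _)); lra.
Unshelve. all: by end_near. Qed.

End ekeland.

(** * Bounds for the upper limit *)

Section upper_limit_bounds.
Context {R : realType} {X Y : metricType R}.
Implicit Types (q : X * Y -> R) (A : set (X * Y)) (z : X * Y).

Lemma upper_limit_ge q A z (a : \bar R) :
  (forall rho, 0 < rho -> (a <= sup_near q A z rho)%E) ->
  (a <= upper_limit q A z)%E.
Proof.
move=> aq; apply: lime_ge; first exact: is_cvg_sup_near.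
by near=> rho; apply: aq; near: rho; exact: nbhs_right_gt.
Unshelve. all: by end_near. Qed.

(** Otherwise [a] bounds every supremum, an empty one included. The nearness of [w] to [z] is
    dropped, as Ekeland-minimality is global. *)
Lemma upper_limit_gt q A z (a : R) :
  (a%:E < upper_limit q A z)%E -> exists2 w, A w & a < q w.
Proof.
move=> aq; apply: contrapT => none; move: aq; apply/negP; rewrite -leNgt.
apply: lime_le; first exact: is_cvg_sup_near.
apply: nearW => rho; apply: ge_ereal_sup => _ [w [Aw _ _] <-].
by rewrite lee_fin leNgt; apply/negP => aqw; apply: none; exists w.
Qed.

End upper_limit_bounds.

(** * The distance d_gamma on the product *)

Section dmax_theory.
Context {R : realType} {X Y : metricType R}.
Variables (gamma : R) (gamma_gt0 : 0 < gamma).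
Implicit Types z w : X * Y.

Lemma dmax_xx z : dmax gamma z z = 0.
Proof. by rewrite /dmax !mdistxx mulr0 maxxx. Qed.

Lemma dmax_ge0 z w : 0 <= dmax gamma z w.
Proof. by rewrite le_max mdist_ge0. Qed.

Lemma dmax_sym z w : dmax gamma z w = dmax gamma w z.
Proof. by rewrite /dmax metric_sym (metric_sym z.2). Qed.

Lemma dmax_le0 z w : dmax gamma z w <= 0 -> z = w.
Proof.
rewrite ge_max pmulr_rle0// => /andP[d1 d2].
case: z w d1 d2 => [z1 z2] [w1 w2] /= d1 d2.
by congr pair; apply: mdist_positivity; apply/le_anti; rewrite ?d1 ?d2 mdist_ge0.
Qed.

Lemma dmax_triangle z v w : dmax gamma z w <= dmax gamma z v + dmax gamma v w.
Proof.
rewrite ge_max; apply/andP; split.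
  apply: le_trans (metric_triangle _ v.1 _) _.
  by apply: lerD; rewrite le_max lexx.
apply: le_trans (ler_wpM2l (ltW gamma_gt0) (metric_triangle _ v.2 _)) _.
by rewrite mulrDr; apply: lerD; rewrite le_max lexx orbT.
Qed.

End dmax_theory.

(** * Completeness of closed graphs for d_gamma *)

Lemma cvg_of_mdist_cauchy (R : realType) (X : completeMetricType R)
    (u : nat -> X) :
  (forall e, 0 < e ->
    exists N, forall n, (N <= n)%N -> mdist (u N) (u n) <= e) ->
  cvg (u @ \oo).
Proof.
move=> uc; apply/cauchy_cvgP/cauchy_exP => e e0.
(* Halving [e] yields the strict inequality that an open ball requires. *)
have [|N uN] := uc (e / 2); first by rewrite divr_gt0.
exists (u N); exists N => // n /= /uN; rewrite ballEmdist /= => h.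
by apply: le_lt_trans h _; rewrite ltr_pdivrMr// ltr_pMr// ltr1n.
Qed.

(** As [gamma > 0], Cauchy sequences and limits for [dmax gamma] are componentwise, so closedness in
    the product topology puts the limit in [A]. *)
Lemma closed_dmax_complete (R : realType) (X Y : completeMetricType R)
    (gamma : R) (A : set (X * Y)) (u : nat -> X * Y) :
  0 < gamma -> closed A -> (forall n, A (u n)) ->
  (forall e, 0 < e ->
    exists N, forall n, (N <= n)%N -> dmax gamma (u N) (u n) <= e) ->
  exists2 l, A l & forall e, 0 < e -> \forall n \near \oo, dmax gamma (u n) l < e.
Proof.
move=> g0 clA Au uc.
have /cvg_ex[l1 ul1] : cvg ((fun n => (u n).1) @ \oo).
  apply: cvg_of_mdist_cauchy => e /uc[N uN]; exists N => n /uN.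
  by rewrite ge_max => /andP[].
have /cvg_ex[l2 ul2] : cvg ((fun n => (u n).2) @ \oo).
  apply: cvg_of_mdist_cauchy => e e0.
  have [|N uN] := uc (gamma * e); first by rewrite mulr_gt0.
  exists N => n /uN.
  by rewrite ge_max ler_pM2l// => /andP[].
exists (l1, l2).
  apply: (@closed_cvg _ _ \oo _ u _ clA); first exact: nearW.
  rewrite (_ : u = fun n => ((u n).1, (u n).2)); first exact: cvg_pair.
  by apply/funext => n; case: (u n).
move=> e e0; near=> n; rewrite gt_max; apply/andP; split.
  rewrite metric_sym; near: n.
  exact: (metricType_numDomainType.cvgr_dist_lt ul1).
rewrite mulrC -ltr_pdivlMr// metric_sym; near: n.
by apply: (metricType_numDomainType.cvgr_dist_lt ul2); rewrite divr_gt0.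
Unshelve. all: by end_near. Qed.

(** A strict bound leaves room to lower the factor [a] slightly; this will supply Ekeland slopes
    below [alpha]. *)
Lemma near_left_lt_mule (R : realType) (a r : R) (D : \bar R) :
  0 < a -> 0 <= r -> (r%:E < a%:E * D)%E ->
  \forall c \near a^'-, (r%:E < c%:E * D)%E.
Proof.
move=> a0 r0; case: D => [D| |].
- rewrite -EFinM lte_fin => raD.
  have D0 : 0 < D by rewrite -(pmulr_rgt0 _ a0); exact: le_lt_trans raD.
  near=> c; rewrite -EFinM lte_fin -ltr_pdivrMr//.
  by near: c; apply: nbhs_left_gt; rewrite ltr_pdivrMr.
- move=> _; near=> c; rewrite gt0_muley ?ltry// lte_fin.
  by near: c; exact: nbhs_left_gt.
- by rewrite gt0_muleNy ?lte_fin// ltNge leNye.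
Unshelve. all: by end_near. Qed.

(** * Part (i): from subregularity to the slope condition *)

Lemma subregular_slope (R : realType) (P : Type) (alpha : R)
    (delta mu : \bar R) (X Y : normedModType R)
    (F : P -> norm_metric X -> set (norm_metric Y))
    (xbar : norm_metric X) (ybar : norm_metric Y)
    (p : P) (x : norm_metric X) (y : norm_metric Y) :
  0 < alpha -> (0 < mu)%E ->
  @convex_set R (norm_metric X * norm_metric Y)%type (gph (F p)) ->
  uniformly_subregular F xbar ybar alpha delta mu ->
  eball xbar delta x -> ~ inv_image (F p) ybar x ->
  (F p x `&` eball ybar (alpha%:E * mu)%E) y ->
  slope_condition (F p) xbar ybar alpha delta mu alpha^-1 x y.
Proof.
move=> a0 mu0 cvxF subF xd nFx [Fxy ymu].
set r := mdist y ybar.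
have r0 : 0 < r.
  by rewrite mdist_gt0; apply/eqP => yy; apply: nFx; rewrite /inv_image/= -yy.
have dr : (dist_set ybar (F p x) <= r%:E)%E.
  by apply: ereal_inf_lbound; exists y => //; rewrite metric_sym.
have aDr := le_trans (subF p x xd (le_lt_trans dr ymu)) dr.
apply: upper_limit_ge => rho rho0; apply/lee_subgt0Pr => e e0.
(* A slope in [alpha - e, alpha[; the term [alpha / 2] keeps it positive when [e] is large. *)
pose c := Num.max (alpha - e) (alpha / 2).
have c0 : 0 < c by rewrite lt_max divr_gt0// orbT.
have ca : c < alpha.
  by rewrite gt_max ltrBlDr ltrDl e0 ltr_pdivrMr// ltr_pMr// ltr1n.
apply: (@le_trans _ _ c%:E); first by rewrite -EFinB lee_fin le_max lexx.
(* The almost-projection [xh]: alpha d(x, solutions) <= r with [r > 0] and [c < alpha] makes that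
   distance less than [r / c]. *)
have [_ [xh Fxh <-]] : exists2 k, [set (mdist x w)%:E | w in inv_image (F p) ybar] k &
    (k < (r / c)%:E)%E.
  apply: ereal_inf_lt.
  rewrite -(@lte_pmul2l _ alpha%:E)// ?lte_fin//.
  apply: le_lt_trans aDr _.
  by rewrite -EFinM lte_fin mulrA ltr_pdivlMr// mulrC ltr_pM2r.
set k := mdist x xh; rewrite lte_fin => kr.
have k0 : 0 <= k by exact: mdist_ge0.
have [m m0 mmu] : exists2 m : R, 0 < m & (m%:E <= mu)%E.
  case: mu mu0 {ymu subF} => [m|_|]//; first by exists m.
  by exists 1 => //; rewrite leey.
pose s := Num.min rho m.
have s0 : 0 < s by rewrite lt_min rho0.
have skr0 : 0 < s + k + r by rewrite -addrA addr_gt0// ltr_wpDl.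
(* Makes t (k + r) < s, so both components move by less than [rho] and by less than the finite
   [m <= mu]. *)
pose t := s / (s + k + r).
have t0 : 0 < t by rewrite divr_gt0.
have t1 : t <= 1 by rewrite ler_pdivrMr// mul1r; lra.
have tkr : t * (k + r) < s.
  by rewrite mulrAC ltr_pdivrMr// ltr_pM2l//; lra.
have tk0 : 0 <= t * k by rewrite mulr_ge0// ltW.
have tr0 : 0 < t * r by rewrite mulr_gt0.
rewrite mulrDr in tkr; clearbody t.
pose u : norm_metric X := t *: xh + (1 - t) *: x.
pose v : norm_metric Y := t *: ybar + (1 - t) *: y.
have ux : mdist u x = t * k.
  rewrite mdist_norm_metric /k metric_sym mdist_norm_metric.
  rewrite -[X in _ = X * _]gtr0_norm// -normrZ; congr `|_|.
  by rewrite /u scalerBl scale1r scalerBr addrA addrAC addrK.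
have vy : mdist v y = t * r.
  rewrite mdist_norm_metric /r metric_sym mdist_norm_metric.
  rewrite -[X in _ = X * _]gtr0_norm// -normrZ; congr `|_|.
  by rewrite /v scalerBl scale1r scalerBr addrA addrAC addrK.
have vyb : mdist v ybar = (1 - t) * r.
  rewrite !mdist_norm_metric /r mdist_norm_metric.
  rewrite -[X in _ = X * _]ger0_norm ?subr_ge0// -normrZ; congr `|_|.
  rewrite /v scalerBr addrAC addrC; congr +%R.
  by rewrite scalerBl scale1r opprB.
(* The factor [t] cancels: the quotient is r / max(k, r / alpha), and the claim reduces to c k <= r
   and c <= alpha. *)
have qc : c <= (mdist y ybar - mdist v ybar) / dmax alpha^-1 (u, v) (x, y).
  have rt : r - (1 - t) * r = t * r by rewrite mulrBl mul1r subKr.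
  rewrite vyb -/r rt /dmax/= ux vy.
  have max0 : 0 < Num.max (t * k) (alpha^-1 * (t * r)).
    by rewrite lt_max [X in _ || X]mulr_gt0 ?orbT// invr_gt0.
  rewrite ler_pdivlMr// mulrC -ler_pdivlMr// ge_max -mulrA ler_pM2l// (ltW kr)/=.
  by rewrite [leLHS]mulrC mulrA ler_pM2l// lef_pV2 ?posrE// ltW.
apply: (@le_trans _ _
  ((mdist y ybar - mdist v ybar) / dmax alpha^-1 (u, v) (x, y))%:E) => //.
apply: ereal_sup_ubound; exists (u, v) => //; split=> /=.
- split=> /=.
  + have := cvxF (xh, ybar) (x, y) (Itv01 (ltW t0) t1) (mem_set Fxh) (mem_set Fxy).
    by move=> /set_mem.
  + by case=> _ vy0; move: tr0; rewrite -vy vy0 mdistxx ltxx.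
  + rewrite /eball/= in xd.
    apply: (@le_lt_trans _ _ ((mdist x xbar)%:E + m%:E)%E).
      rewrite -EFinD lee_fin; apply: le_trans (metric_triangle _ x _) _.
      rewrite addrC lerD2l ux.
      have : s <= m by rewrite ge_min lexx orbT.
      lra.
    exact: lte_leD.
  + apply: le_lt_trans ymu; rewrite lee_fin vyb -/r.
    by rewrite ler_piMl ?(ltW r0)// gerBl ltW.
- rewrite ux; have : s <= rho by rewrite ge_min lexx.
  lra.
- rewrite vy; have : s <= rho by rewrite ge_min lexx.
  lra.
Qed.

(** * Part (ii): from the slope condition to subregularity *)

Lemma slope_subregular (R : realType) (P : Type) (alpha gamma : R)
    (delta mu : \bar R) (X Y : completeMetricType R) (F : P -> X -> set Y)
    (xbar : X) (ybar : Y) :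
  0 < alpha -> 0 < gamma -> (forall p, closed (gph (F p))) ->
  (forall (p : P) (x : X) (y : Y),
     eball xbar (delta + mu)%E x -> ~ inv_image (F p) ybar x ->
     (F p x `&` eball ybar (alpha%:E * mu)%E) y ->
     slope_condition (F p) xbar ybar alpha delta mu gamma x y) ->
  uniformly_subregular F xbar ybar alpha delta mu.
Proof.
move=> a0 g0 clF slope p x xd dmu; rewrite leNgt; apply/negP => dD.
have [_ [y Fxy <-]] : exists2 k, [set (mdist ybar w)%:E | w in F p x] k &
    (k < Order.min (alpha%:E * dist_set x (inv_image (F p) ybar))
               (alpha%:E * mu))%E.
  by apply: ereal_inf_lt; rewrite lt_min dD.
rewrite lt_min metric_sym => /andP[yD ymu].
(* [c] is so close to [alpha] that both strict bounds on d(y, ybar) survive with [c] in place of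
   [alpha]. *)
near alpha^'- => c.
have c0 : 0 < c by near: c; exact: nbhs_left_gt.
have ca : c < alpha by near: c; exact: nbhs_left_lt.
have ycD : ((mdist y ybar)%:E < c%:E * dist_set x (inv_image (F p) ybar))%E.
  by near: c; apply: near_left_lt_mule => //; exact: mdist_ge0.
have ycmu : ((mdist y ybar)%:E < c%:E * mu)%E.
  by near: c; apply: near_left_lt_mule => //; exact: mdist_ge0.
have f_lsc (w : X * Y) e : 0 < e -> exists2 r, 0 < r &
    forall z, gph (F p) z -> dmax gamma z w < r ->
    mdist w.2 ybar <= mdist z.2 ybar + e.
  move=> e0; exists (gamma * e); first by rewrite mulr_gt0.
  move=> z _; rewrite gt_max ltr_pM2l// => /andP[_ zw].
  apply: le_trans (metric_triangle _ z.2 _) _; rewrite metric_sym; lra.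
have [[u v] [Guv /= uvx uvmin]] := ekeland (dmax_xx gamma) (dmax_le0 g0)
  (dmax_sym gamma) (dmax_triangle g0)
  (fun u => @closed_dmax_complete _ _ _ _ _ u g0 (clF p))
  (fun w _ => mdist_ge0 w.2 ybar) f_lsc c0 (Fxy : gph (F p) (x, y)).
have cux : c * mdist u x <= mdist y ybar.
  apply: le_trans uvx; rewrite ler_wpDl ?mdist_ge0// ler_pM2l// dmax_sym.
  by rewrite le_max lexx.
have vy : mdist v ybar <= mdist y ybar.
  by apply: le_trans uvx; rewrite lerDl mulr_ge0 ?dmax_ge0// ltW.
(* A solution [u] would give c d(x, solutions) <= c d(u, x) <= d(y, ybar), against [ycD]. *)
have uD : ~ inv_image (F p) ybar u.
  move=> Fu; move: ycD; apply/negP; rewrite -leNgt.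
  apply: (@le_trans _ _ (c%:E * (mdist u x)%:E)%E); last by rewrite -EFinM lee_fin.
  rewrite lee_pmul2l// ?lte_fin//.
  by apply: ereal_inf_lbound; exists u => //; rewrite metric_sym.
have umu : ((mdist u x)%:E < mu)%E.
  rewrite -(@lte_pmul2l _ c%:E)// ?lte_fin//.
  by apply: le_lt_trans ycmu; rewrite -EFinM lee_fin.
(* Ekeland's point may leave the [delta]-ball, but by less than [mu]: hence the radius [delta + mu]
   in the hypothesis. *)
have ud : eball xbar (delta + mu)%E u.
  rewrite /eball/= addeC; apply: le_lt_trans (lteD umu xd).
  by rewrite -EFinD lee_fin metric_triangle.
have vmu : eball ybar (alpha%:E * mu)%E v.
  by apply: (@le_lt_trans _ _ (mdist y ybar)%:E); first rewrite lee_fin.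
have := slope p u v ud uD (conj Guv vmu).
rewrite /slope_condition => /(lt_le_trans _) h.
have /h/upper_limit_gt[w [Gw wuv _ _] cw] : (c%:E < alpha%:E)%E by rewrite lte_fin.
apply/wuv/uvmin => //.
(* Division by 0 yields 0 here, so a quotient above [c > 0] has a nonzero denominator. *)
have dw0 : 0 < dmax gamma w (u, v).
  rewrite lt_neqAle dmax_ge0 andbT eq_sym; apply/eqP => dw.
  by move: cw; rewrite dw invr0 mulr0 ltNge ltW.
by move: cw; rewrite ltr_pdivlMr// dmax_sym; lra.
Unshelve. all: by end_near. Qed.

Theorem corollary3p4 (R : realType) (P : Type) (P_nonempty : inhabited P)
    (alpha : R) (delta mu : \bar R) (alpha_gt0 : 0 < alpha)
    (delta_gt0 : (0 < delta)%E) (mu_gt0 : (0 < mu)%E) :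
  (forall (X Y : normedModType R)
      (F : P -> norm_metric X -> set (norm_metric Y))
      (xbar : norm_metric X) (ybar : norm_metric Y),
    (forall p : P,
       @convex_set R (norm_metric X * norm_metric Y)%type (gph (F p))) ->
    uniformly_subregular F xbar ybar alpha delta mu ->
    forall (p : P) (x : norm_metric X) (y : norm_metric Y),
      eball xbar delta x ->
      ~ inv_image (F p) ybar x ->
      (F p x `&` eball ybar (alpha%:E * mu)%E) y ->
      slope_condition (F p) xbar ybar alpha delta mu alpha^-1 x y)
  /\
  (forall (X Y : completeMetricType R) (F : P -> X -> set Y)
      (xbar : X) (ybar : Y),
    (forall p : P, closed (gph (F p))) ->
    (exists2 gamma : R, 0 < gamma &
       forall (p : P) (x : X) (y : Y),
         eball xbar (delta + mu)%E x ->
         ~ inv_image (F p) ybar x ->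
         (F p x `&` eball ybar (alpha%:E * mu)%E) y ->
         slope_condition (F p) xbar ybar alpha delta mu gamma x y) ->
    uniformly_subregular F xbar ybar alpha delta mu).
Proof.
split=> [X Y F xbar ybar cvxF subF p x y xd nFx Fxy|X Y F xbar ybar clF].
  exact: subregular_slope.
by case=> gamma gamma0; exact: slope_subregular.
Qed.
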